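(* Let $\alpha$ be an admissible assigning of a graph $G$. Then \[ P(G,\alpha;k)=P\big(D(G),f;A\big) \] for every orientation $D$ of $G$, every Abelian group $A$ of order $k$ and every function $f:E(G)\to A$ satisfying $\alpha_{D,f}=\alpha$. Here $P(G,\alpha;k)$ is the cycle-assigning polynomial of $G$ and $P\big(D(G),f;A\big)$ is the number of $(A,f)$-colorings of $G$ under $D$.
   Context: Graphs are finite and may have loops and multiple edges; Abelian groups $A$ are additive and finite. An orientation $D$ of $G$ assigns a direction to each edge. A vertex coloring $c:V(G)\to A$ is an $(A,f)$-coloring of $G$ under $D$ if $c(v)-c(u)\neq f(e)$ for each edge $e=uv$ oriented from $u$ to $v$ under $D$ (for a loop, $u=v$). A cycle of $G$ is a connected 2-regular subgraph (a loop with its vertex is a cycle with one edge; two parallel edges form a cycle); $\mathcal{C}(G)$ is the set of cycles of $G$. An assigning of $G$ is a map $\alpha:\mathcal{C}(G)\to\{0,1\}$. For each cycle $C$ fix one of its two directions $o(C)$ and define $\eta_{D(C)}:E(G)\to\{0,\pm1\}$ by $\eta_{D(C)}(e)=1$ if $e\in E(C)$ and the direction of $e$ under $D$ is consistent with $o(C)$, $-1$ if $e\in E(C)$ and the direction of $e$ is opposite to $o(C)$, and $0$ if $e\notin E(C)$. The assigning $\alpha_{D,f}$ induced by $f:E(G)\to A$ is $\alpha_{D,f}(C)=0$ if $\sum_{e\in E(C)}\eta_{D(C)}(e)f(e)=0$ and $\alpha_{D,f}(C)=1$ otherwise (independent of the choices $o(C)$). An assigning $\alpha$ is ($D$-)admissible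 if $\alpha=\alpha_{D,f}$ for some finite Abelian group $A$ and some $f:E(G)\to A$ (this does not depend on the orientation, since reversing an edge amounts to negating $f$ there). A subgraph $H$ of $G$ is $\alpha$-compatible if $\alpha(C)=0$ for every cycle $C$ of $H$. The cycle-assigning polynomial of $G$ for an assigning $\alpha$ is \[ P(G,\alpha;k):=\sum_{H}(-1)^{|E(H)|}k^{c(H)}, \] the sum over all $\alpha$-compatible spanning subgraphs $H$ of $G$ (spanning: $V(H)=V(G)$), where $c(H)$ is the number of components of $H$. *)

(* Defs.v *)
From HB Require Import structures.
From mathcomp Require Import all_boot all_order all_algebra.

Set Implicit Arguments.
Unset Strict Implicit.
Unset Printing Implicit Defensive.

Import GRing.Theory.
Local Open Scope ring_scope.

(* Undirected multigraph, loops allowed.  Each edge [e] has two half-edges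
   [(e, false)] and [(e, true)], attached to the vertices [inc e false] and
   [inc e true]; which half-edge bears which label is immaterial.  Loops are
   the edges with [inc e false = inc e true]. *)
Record mgraph := MGraph {
  vertex : finType;
  edge : finType;
  inc : edge -> bool -> vertex
}.

Section Subgraphs.
Variable G : mgraph.

Definition is_subgraph (H : {set vertex G} * {set edge G}) : bool :=
  [forall e in H.2, forall b, inc e b \in H.1].

Definition subgraph := {H : {set vertex G} * {set edge G} | is_subgraph H}.

Definition vset (H : subgraph) : {set vertex G} := (val H).1.
Definition eset (H : subgraph) : {set edge G} := (val H).2.

Definition spanning (H : subgraph) : bool := vset H == setT.

(* Counting half-edges makes a loop contribute 2. *)
Definition degree (H : subgraph) (v : vertex G) : nat :=
  #|[set h : edge G * bool | (h.1 \in eset H) && (inc h.1 h.2 == v)]|.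

Definition adjacent (H : subgraph) : rel (vertex G) :=
  [rel u v | [exists e in eset H,
     exists b, (inc e b == u) && (inc e (~~ b) == v)]].

Definition ncomponents (H : subgraph) : nat := n_comp (adjacent H) (vset H).

Definition is_cycle (C : subgraph) : bool :=
  (ncomponents C == 1%N) && [forall v in vset C, degree C v == 2%N].

Definition gcycle := {C : subgraph | is_cycle C}.

Definition cycle_of (C : gcycle) (H : subgraph) : bool :=
  (vset (val C) \subset vset H) && (eset (val C) \subset eset H).

Definition assigning := {ffun gcycle -> bool}.

(* An orientation selects the half-edge of [e] lying at the head of [e]; in
   particular a loop has two orientations. *)
Definition orientation := {ffun edge G -> bool}.

Definition head_vertex (D : orientation) (e : edge G) : vertex G := inc e (D e).
Definition tail_vertex (D : orientation) (e : edge G) : vertex G := inc e (~~ D e).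

(* A direction of the cycle [C] orients its edges so that every vertex of [C]
   is entered once and left once; [o] is arbitrary off [C], where it is never
   used.  Restricted to the edges of [C] there are exactly two of them. *)
Definition is_direction (C : gcycle) (o : orientation) : bool :=
  [forall v in vset (val C),
     (#|[set e in eset (val C) | head_vertex o e == v]| == 1%N) &&
     (#|[set e in eset (val C) | tail_vertex o e == v]| == 1%N)].

Definition direction (C : gcycle) := {o : orientation | is_direction C o}.

Definition cycle_directions := forall C : gcycle, direction C.

Definition eta (D : orientation) (C : gcycle) (o : direction C) (e : edge G) :
    int :=
  if e \in eset (val C) then (if D e == val o e then 1 else -1) else 0.

(* [true] encodes the value 1 and [false] the value 0. *)
Definition induced_assigning (o : cycle_directions) (D : orientation)
    (A : finZmodType) (f : edge G -> A) : assigning :=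
  [ffun C => \sum_(e in eset (val C)) f e *~ eta D (o C) e != 0].

Definition admissible (o : cycle_directions) (alpha : assigning) : Prop :=
  exists (D : orientation) (A : finZmodType) (f : edge G -> A),
    alpha = induced_assigning o D f.

Definition compatible (alpha : assigning) (H : subgraph) : bool :=
  [forall C : gcycle, cycle_of C H ==> ~~ alpha C].

Definition cycle_assigning_poly (alpha : assigning) : {poly int} :=
  \sum_(H : subgraph | spanning H && compatible alpha H)
     (-1) ^+ #|eset H| *: 'X^(ncomponents H).

Definition is_coloring (D : orientation) (A : finZmodType) (f : edge G -> A)
    (c : {ffun vertex G -> A}) : bool :=
  [forall e, c (head_vertex D e) - c (tail_vertex D e) != f e].

Definition ncolorings (D : orientation) (A : finZmodType) (f : edge G -> A) :
    nat :=
  #|[set c : {ffun vertex G -> A} | is_coloring D f c]|.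

End Subgraphs.

(* Main.v *)
Require Import Defs.
From HB Require Import structures.
From mathcomp Require Import all_boot all_order all_algebra.

(** The colorings are counted by inclusion-exclusion over the set [E] of edges
    on which the forbidden equality [c (head e) - c (tail e) = f e] holds:
    [ncolorings] is the sum over [E] of [(-1) ^+ #|E|] times the number of [c]
    that solve these equations for all [e] in [E].  The edge sets [E] are the
    spanning subgraphs, so it suffices that the system on [E] has
    [k ^ ncomponents] solutions if [E] is compatible and none otherwise.

    The equations are affine: two solutions differ by a map that is constant on
    the components, whence the power of [k] as soon as one solution exists
    ([card_potentials]).  A difference [c (head e) - c (tail e)] sums to zero
    around every directed cycle ([sum_tension_cycle]), so a solvable system is
    compatible.  Conversely ([compatible_potential]), a solution on a compatible
    set is built one edge [e] at a time.  If [e] joins two components, one of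
    them is shifted.  Otherwise [e] closes a cycle ([cycle_through_edge]), and as
    both [f] and the differences of the solution found so far sum to zero around
    it and agree on its other edges, they agree on [e].

    In this last step the two sums are compared only through their difference,
    whose single possibly nonzero term sits at [e]; hence the direction chosen
    for the cycle never has to be computed. *)

Set Implicit Arguments.
Unset Strict Implicit.
Unset Printing Implicit Defensive.

Import GRing.Theory.
Local Open Scope ring_scope.

Section CycleAssigning.
Variable G : mgraph.
Implicit Types (E : {set edge G}) (H : subgraph G) (C : gcycle G)
  (D : orientation G).

(** * Adjacency and degrees through a set of edges *)

(** The relation [adjacent H] depends only on the edges of [H], and [joined]
    is convertible to it; edge sets can thus vary without carrying vertices. *)
Definition joined E : rel (vertex G) :=
  [rel u v | [exists e in E, exists b, (inc e b == u) && (inc e (~~ b) == v)]].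

Definition edge_degree (e : edge G) (v : vertex G) : nat :=
  \sum_b (inc e b == v).

Lemma joinedP E u v :
  reflect (exists e b, [/\ e \in E, inc e b = u & inc e (~~ b) = v])
          (joined E u v).
Proof.
apply: (iffP idP) => [/exists_inP[e eE /existsP[b /andP[/eqP eu /eqP ev]]]|].
  by exists e, b.
move=> [e [b [eE <- <-]]]; apply/exists_inP; exists e => //.
by apply/existsP; exists b; rewrite !eqxx.
Qed.

Lemma joined_sym E : symmetric (joined E).
Proof.
by move=> u v; apply/joinedP/joinedP => -[e [b [eE <- <-]]];
  exists e, (~~ b); rewrite negbK.
Qed.

Lemma connect_joined_sym E : connect_sym (joined E).
Proof. exact/sym_connect_sym/joined_sym. Qed.

Lemma connect_joinedS E E' u v :
  E \subset E' -> connect (joined E) u v -> connect (joined E') u v.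
Proof.
move=> sEE'; apply: connect_sub => {u v} u v /joinedP[e [b [eE eu ev]]].
by apply/connect1/joinedP; exists e, b; rewrite (subsetP sEE').
Qed.

Lemma edge_degreeE e b v :
  edge_degree e v = ((inc e b == v) + (inc e (~~ b) == v))%N.
Proof. by rewrite /edge_degree big_bool; case: b => //=; rewrite addnC. Qed.

Lemma degreeE H v : degree H v = (\sum_(e in eset H) edge_degree e v)%N.
Proof.
rewrite /degree -sum1dep_card pair_big_dep /=.
rewrite [RHS](eq_bigr (fun h => if inc h.1 h.2 == v then 1 else 0)%N); last first.
  by move=> h _; case: eqP.
by rewrite -big_mkcondr; apply: eq_bigl => h; rewrite andbT.
Qed.

Lemma subgraph_inc H e b : e \in eset H -> inc e b \in vset H.
Proof. by move=> eH; move/forall_inP/(_ e eH)/forallP: (valP H); apply. Qed.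

(** * Closing a cycle *)

(** The degree condition is uniform in [v]: the correction at the two ends is
    exactly the degree that an edge between them contributes, and a one-vertex
    path, where the ends coincide, is corrected by 2. *)
Lemma uniq_path_edges E x p :
  path (joined E) x p -> uniq (x :: p) ->
  exists2 E' : {set edge G}, E' \subset E &
    [/\ forall e b, e \in E' -> inc e b \in x :: p,
        forall v, v \in x :: p ->
          (\sum_(e in E') edge_degree e v + ((v == x) + (v == last x p)) = 2)%N
      & forall v, v \in x :: p -> connect (joined E') x v].
Proof.
elim: p x => [|y p IHp] x.
  move=> _ _; exists set0; first exact: sub0set.
  split=> [e b|v|v]; first by rewrite inE.
    by rewrite inE => /eqP->; rewrite big_set0 eqxx.
  by rewrite inE => /eqP->.
rewrite [path _ _ _]/= [uniq _]cons_uniq.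
move=> /andP[/joinedP[e [b [eE ex ey]]] yp] /andP[xp up].
have [E' sE'E [incE' degE' conE']] := IHp y yp up.
have eE' : e \notin E'.
  by apply: contra xp => eE'; rewrite -ex; exact: incE'.
exists (e |: E'); first by rewrite subUset sub1set eE.
have xy : y != x by apply: contraNneq xp => <-; rewrite mem_head.
split=> [e' b'|v|v].
- case/setU1P=> [->|/incE' ip]; last by rewrite inE ip orbT.
  have [->|/negPf bb'] := eqVneq b' b; first by rewrite ex mem_head.
  have -> : b' = ~~ b by case: b b' bb' {ex ey} => [] [].
  by rewrite ey inE mem_head orbT.
- rewrite big_setU1 //= (edge_degreeE e b) ex ey [x == v]eq_sym [y == v]eq_sym.
  rewrite inE => /orP[/eqP->|vp].
    rewrite big1 => [|e' e'E'].
      rewrite eqxx [x == y]eq_sym (negPf xy); case: eqP => // xl.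
      by case/negP: xp; rewrite {1}xl mem_last.
    rewrite /edge_degree big1 // => b' _; apply/eqP; rewrite eqb0.
    by apply: contra xp => /eqP <-; exact: incE'.
  have vx : v != x by apply: contraNneq xp => <-.
  by rewrite (negPf vx) !add0n -(degE' v vp) addnCA addnA.
- rewrite inE => /orP[/eqP->|vp]; first exact: connect0.
  apply: (@connect_trans _ _ y).
    by apply/connect1/joinedP; exists e, b; rewrite setU11.
  exact: connect_joinedS (subsetUr _ _) (conE' v vp).
Qed.

(** A walk between the ends of [e] shortens to a path without repeated vertices,
    and [e] closes that path; loops and parallel edges are no exceptions, the
    path then having no edge or one edge. *)
Lemma cycle_through_edge E e :
  e \notin E -> connect (joined E) (inc e false) (inc e true) ->
  exists2 C : gcycle G, eset (val C) \subset e |: E & e \in eset (val C).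
Proof.
move=> eE /connectP[p0 p0P last0].
case: (shortenP p0P) last0 => p pP up _ lastp.
have [E' sE'E [incE' degE' conE']] := uniq_path_edges pP up.
have eE' : e \notin E' by apply: contra eE; exact: (subsetP sE'E).
pose x := inc e false; pose V := [set v in x :: p].
have sub : is_subgraph (V, e |: E').
  apply/forall_inP => e' /= /setU1P[->|e'E']; apply/forallP => b.
    by rewrite inE; case: b; rewrite ?lastp ?mem_last ?mem_head.
  by rewrite inE incE'.
pose H : subgraph G := exist _ (V, e |: E') sub.
have cycH : is_cycle H.
  apply/andP; split; last first.
    apply/forall_inP => v; rewrite inE => vp.
    rewrite degreeE big_setU1 //= (edge_degreeE e false) /= addnC lastp.
    by rewrite -(degE' v vp) [_ == v]eq_sym [last _ _ == v]eq_sym.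
  have symH : connect_sym (adjacent H) by exact: (@connect_joined_sym (e |: E')).
  rewrite /ncomponents -(n_comp_connect symH x); apply/eqP.
  apply: eq_n_comp_r => v; rewrite inE; apply/idP/idP => [vp|].
    exact: (connect_joinedS (subsetUr [set e] E') (conE' v vp)).
  have clV : closed (adjacent H) (mem V).
    apply: (intro_closed symH) => u w /joinedP[e' [b [e'H _ <-]]] _.
    exact: (@subgraph_inc H).
  move=> /(closed_connect clV); rewrite /= [x \in _]inE mem_head => /esym.
  by rewrite inE.
exists (exist _ H cycH); last exact: setU11.
exact: setUS.
Qed.

(** * Potentials and cycle sums *)

Variables (D : orientation G) (A : finZmodType).
Implicit Types (c : {ffun vertex G -> A}) (f : edge G -> A).

Definition tension c (e : edge G) : A :=
  c (head_vertex D e) - c (tail_vertex D e).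

Definition potentials f E : {set {ffun vertex G -> A}} :=
  [set c | [forall e in E, tension c e == f e]].

Lemma potentialsP f E c :
  reflect {in E, tension c =1 f} (c \in potentials f E).
Proof.
by rewrite inE; apply: (iffP forall_inP) => h e eE; apply/eqP; exact: h.
Qed.

Lemma sum_fiber1 (V : {set vertex G}) E (h : edge G -> vertex G) c :
    {in E, forall e, h e \in V} ->
    {in V, forall v, #|[set e in E | h e == v]| = 1%N} ->
  \sum_(e in E) c (h e) = \sum_(v in V) c v.
Proof.
move=> hV h1; rewrite (partition_big h (mem V)) //=; apply: eq_bigr => v vV.
transitivity (\sum_(e in [set e in E | h e == v]) c v).
  by apply: eq_big => [e|e /andP[_ /eqP->]]; rewrite ?inE.
by rewrite sumr_const h1.
Qed.

(** Along a direction of [C] each vertex is once a head and once a tail, so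
    the two sums over the vertices cancel. *)
Lemma sum_tension_cycle c C (u : direction C) :
  \sum_(e in eset (val C)) tension c e *~ Defs.eta D u e = 0.
Proof.
have etaE e : e \in eset (val C) ->
    tension c e *~ Defs.eta D u e
    = c (head_vertex (val u) e) - c (tail_vertex (val u) e).
  move=> eC; rewrite /Defs.eta eC /tension /head_vertex /tail_vertex.
  by case: (D e); case: (val u e); rewrite /= ?mulr1z ?mulrN1z ?opprB.
have dirP v : v \in vset (val C) ->
    #|[set e in eset (val C) | head_vertex (val u) e == v]| = 1%N
    /\ #|[set e in eset (val C) | tail_vertex (val u) e == v]| = 1%N.
  by move=> vC; have /forall_inP/(_ v vC)/andP[/eqP hv /eqP tv] := valP u.
rewrite (eq_bigr _ etaE) sumrB.
rewrite (@sum_fiber1 (vset (val C)) _ (head_vertex (val u))).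
- rewrite (@sum_fiber1 (vset (val C)) _ (tail_vertex (val u))) ?subrr //.
    by move=> e eC; exact: subgraph_inc.
  by move=> v /dirP[].
- by move=> e eC; exact: subgraph_inc.
- by move=> v /dirP[].
Qed.

Lemma mulrz_eta_eq0 C (u : direction C) (e : edge G) (a : A) :
  e \in eset (val C) -> (a *~ Defs.eta D u e == 0) = (a == 0).
Proof.
move=> eC; rewrite /Defs.eta eC; case: (D e == _); first by rewrite mulr1z.
by rewrite mulrN1z oppr_eq0.
Qed.

(** * Solvability of the system on an edge set *)

Definition zero_on_cycles (o : cycle_directions G) f E :=
  forall C, eset (val C) \subset E ->
    \sum_(e in eset (val C)) f e *~ Defs.eta D (o C) e = 0.

Lemma potential_compatible o f E c :
  c \in potentials f E -> zero_on_cycles o f E.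
Proof.
move=> /potentialsP cE C sCE; rewrite -[RHS](sum_tension_cycle c (o C)).
by apply: eq_bigr => e eC; rewrite cE // (subsetP sCE).
Qed.

(** Induction on the number of edges: a solution for [E :\ e] is either
    shifted on the component of the head of [e] or already solves the equation
    at [e]. *)
Lemma compatible_potential o f E :
  zero_on_cycles o f E -> exists c, c \in potentials f E.
Proof.
elim: {E}#|E| {-2}E (erefl #|E|) => [|n IHn] E cardE fE.
  exists [ffun=> 0]; apply/potentialsP => e.
  by rewrite (cards0_eq cardE) inE.
have [e eE] : exists e, e \in E by apply/card_gt0P; rewrite cardE.
pose E' := E :\ e; have EE' : E = e |: E' by rewrite setD1K.
have eE' : e \notin E' by rewrite !inE eqxx.
have [||c cP] := IHn E'.
- by move: cardE; rewrite (cardsD1 e) eE => -[].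
- by move=> C sCE'; apply: fE; rewrite (subset_trans sCE') ?subD1set.
have cE' := potentialsP _ _ _ cP.
have [con|ncon] :=
    boolP (connect (joined E') (head_vertex D e) (tail_vertex D e)).
  have {}con : connect (joined E') (inc e false) (inc e true).
    move: con; rewrite /head_vertex /tail_vertex; case: (D e) => //=.
    by rewrite connect_joined_sym.
  have [C sC eC] := cycle_through_edge eE' con.
  exists c; apply/potentialsP => e'; rewrite {1}EE' => /setU1P[->|]; last exact: cE'.
  apply/eqP; rewrite -subr_eq0 -(mulrz_eta_eq0 (o C) _ eC).
  (* All terms but the one at [e] vanish, as [c] solves the other equations. *)
  have : \sum_(e' in eset (val C)) (tension c e' - f e') *~ Defs.eta D (o C) e' = 0.
    rewrite (eq_bigr (fun e' => tension c e' *~ Defs.eta D (o C) e'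
                                - f e' *~ Defs.eta D (o C) e')).
      by rewrite sumrB sum_tension_cycle fE ?EE' // subrr.
    by move=> e1 _; rewrite mulrzBl.
  rewrite (bigD1 e) //= big1 ?addr0 => [-> //|e1 /andP[e1C e1e]].
  have e1E' : e1 \in E' by move: (subsetP sC _ e1C); rewrite !inE (negPf e1e).
  by rewrite cE' // subrr mul0rz.
pose d := f e - tension c e.
pose shift := [ffun v => c v +
  (if connect (joined E') (head_vertex D e) v then d else 0)].
exists shift; apply/potentialsP => e'; rewrite /tension !ffunE {1}EE'.
case/setU1P=> [->|e'E'].
  by rewrite connect0 (negPf ncon) addr0 addrAC addrC -/(tension c e) subrK.
(* An edge of [E'] has both ends in one component, so the shift keeps its
   tension. *)
have -> : connect (joined E') (head_vertex D e) (head_vertex D e')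
          = connect (joined E') (head_vertex D e) (tail_vertex D e').
  apply/(same_connect_r (@connect_joined_sym E'))/connect1/joinedP.
  by exists e', (D e').
by rewrite opprD addrACA subrr addr0; exact: cE'.
Qed.

(** * Counting the solutions *)

Lemma potentials0P E c :
  reflect (forall v, c v = c (fingraph.root (joined E) v)) (c \in potentials (fun=> 0) E).
Proof.
apply: (iffP (potentialsP _ _ _)) => [c0 v|croot e eE].
  have c1 u w : joined E u w -> c u = c w.
    move=> /joinedP[e [b [eE <- <-]]]; apply/eqP; move: (c0 e eE).
    move/eqP; rewrite /tension subr_eq0 /head_vertex /tail_vertex.
    by case: (D e) b => [] [] //=; rewrite eq_sym.
  have /connectP[p pP ->] := connect_root (joined E) v.
  elim: p v pP => //= w p IHp v /andP[vw wp].
  by rewrite (c1 _ _ vw) (IHp _ wp).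
rewrite /tension [c (head_vertex D e)]croot [c (tail_vertex D e)]croot.
suff /(fingraph.rootP (@connect_joined_sym E))-> :
    connect (joined E) (head_vertex D e) (tail_vertex D e) by rewrite subrr.
by apply/connect1/joinedP; exists e, (D e).
Qed.

(** A map that is constant on the components is determined by its arbitrary
    values at the component roots. *)
Lemma card_potentials0 E :
  #|potentials (fun=> 0) E| = (#|A| ^ n_comp (joined E) setT)%N.
Proof.
pose R := [set v | roots (joined E) v].
pose ext (g : {ffun vertex G -> A}) := [ffun v => g (fingraph.root (joined E) v)].
have rootR v : fingraph.root (joined E) v \in R.
  by rewrite inE roots_root //; exact: connect_joined_sym.
have -> : n_comp (joined E) setT = #|R|.
  by rewrite /n_comp_mem; apply: eq_card => v; rewrite !inE andbT.
have -> : potentials (fun=> 0) E = ext @: pffun_on (0 : A) (mem R) (mem A).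
  apply/setP => c; apply/potentials0P/imsetP => [croot|[g _ ->] v].
    (* The value [0] off the roots makes the preimage of [c] unique. *)
    exists [ffun v => if v \in R then c v else 0].
      apply/pffun_onP; split=> //; apply/subsetP => v; rewrite !inE ffunE.
      by case: ifP; rewrite ?eqxx // inE.
    by apply/ffunP => v; rewrite !ffunE rootR -croot.
  by rewrite !ffunE root_root //; exact: connect_joined_sym.
rewrite card_in_imset ?card_pffun_on // => g1 g2.
move=> /pffun_onP[/subsetP s1 _] /pffun_onP[/subsetP s2 _] /ffunP eq12.
apply/ffunP => v; have [vR|vR] := boolP (v \in R).
  move: (eq12 v); rewrite !ffunE; move: vR; rewrite inE.
  by rewrite /roots /= => /eqP->.
have zero (g : {ffun vertex G -> A}) :
    {subset 0.-support g <= mem R} -> g v = 0.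
  by move=> sg; apply: contraNeq vR => gv; apply: sg; rewrite inE.
by rewrite (zero g1) ?(zero g2).
Qed.

(** Translation by one solution is a bijection onto the solutions of the
    homogeneous system. *)
Lemma card_potentials f E c :
  c \in potentials f E ->
  #|potentials f E| = (#|A| ^ n_comp (joined E) setT)%N.
Proof.
move=> /potentialsP cE; rewrite -card_potentials0.
rewrite -(card_imset (mem (potentials (fun=> 0) E)) (addrI c)).
have tensionD c1 c2 e : tension (c1 + c2) e = tension c1 e + tension c2 e.
  by rewrite /tension !ffunE opprD addrACA.
apply: eq_card => c'; apply/potentialsP/imsetP => [c'E|[c0 /potentialsP c0E ->]].
  exists (c' - c); last by rewrite addrC subrK.
  apply/potentialsP => e eE; have := tensionD (c' - c) c e.
  by rewrite subrK c'E // cE // => /eqP; rewrite -subr_eq subrr => /eqP <-.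
by move=> e eE; rewrite tensionD cE // c0E // addr0.
Qed.

(** * Inclusion-exclusion *)

Lemma ncolorings_incl_excl f :
  (ncolorings D f)%:Z
  = \sum_(E : {set edge G}) (-1) ^+ #|E| * #|potentials f E|%:Z.
Proof.
have coloringE c : (is_coloring D f c)%:Z
    = \sum_(E : {set edge G}) (-1) ^+ #|E| * (c \in potentials f E)%:Z.
  (* Each edge contributes the factor [1] minus the indicator of a violation. *)
  have -> : (is_coloring D f c)%:Z
      = \prod_e (- (tension c e == f e)%:Z + 1).
    rewrite /is_coloring -/(tension c); case: forallP => [col|ncol].
      by rewrite big1 // => e _; rewrite (negPf (col e)) oppr0 add0r.
    have /existsP[e /negPn/eqP ce] :
        [exists e, ~~ (tension c e != f e)].
      by rewrite -negb_forall; apply/negP => /forallP.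
    by rewrite (bigD1 e) //= ce eqxx addNr mul0r.
  rewrite bigA_distr; apply: eq_bigr => E _.
  rewrite -big_mkcond /= prodrN; congr (_ * _).
  case: potentialsP => [cE|ncE].
    by rewrite big1 // => e eE; rewrite cE // eqxx.
  have /exists_inP[e eE ce] : [exists e in E, tension c e != f e].
    rewrite -negb_forall_in; apply/negP => /forall_inP cE.
    by apply: ncE => e eE; exact/eqP/cE.
  by rewrite (bigD1 e) //= (negPf ce) mul0r.
have natzsum (S : {set {ffun vertex G -> A}}) :
    #|S|%:Z = \sum_c (c \in S)%:Z.
  rewrite -sum1_card -natz natr_sum big_mkcond /=.
  by apply: eq_bigr => c _; case: (c \in S).
rewrite /ncolorings natzsum.
under eq_bigr do rewrite inE coloringE.
rewrite exchange_big /=; apply: eq_bigr => E _.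
by rewrite natzsum mulr_sumr.
Qed.

Lemma is_subgraph_setT E : is_subgraph (setT, E).
Proof. by apply/forall_inP => e _; apply/forallP => b; rewrite inE. Qed.

Definition spanning_subgraph E : subgraph G :=
  exist _ (setT, E) (is_subgraph_setT E).

Lemma compatibleP o f E :
  reflect (zero_on_cycles o f E)
    (compatible (induced_assigning o D f) (spanning_subgraph E)).
Proof.
apply: (iffP forallP) => [comp C sC|zero C].
  apply/eqP; move: (comp C); rewrite /cycle_of subsetT /= ffunE negbK.
  by move/implyP; apply.
rewrite /cycle_of subsetT /= ffunE negbK; apply/implyP => sC.
exact/eqP/zero.
Qed.

Lemma horner_cycle_assigning_poly (alpha : assigning G) (x : int) :
  (cycle_assigning_poly alpha).[x]
  = \sum_(E : {set edge G} | compatible alpha (spanning_subgraph E))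
       (-1) ^+ #|E| * x ^+ n_comp (joined E) setT.
Proof.
rewrite /cycle_assigning_poly horner_sum.
rewrite (reindex_onto spanning_subgraph (@eset G)) => [|H /andP[/eqP sH _]].
  apply: eq_big => [E|E _]; first by rewrite /spanning !eqxx andbT.
  by rewrite hornerZ hornerXn.
by apply: val_inj; rewrite /= -sH /vset /eset -surjective_pairing.
Qed.

End CycleAssigning.

Theorem theorem2p2 (G : mgraph) (o : cycle_directions G) (alpha : assigning G)
    (halpha : admissible o alpha)
    (D : orientation G) (A : finZmodType) (k : nat) (hk : #|A| = k)
    (f : edge G -> A) (hf : induced_assigning o D f = alpha) :
  (cycle_assigning_poly alpha).[k%:Z] = (ncolorings D f)%:Z.
Proof.
rewrite horner_cycle_assigning_poly ncolorings_incl_excl big_mkcond -hf.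
apply: eq_bigr => E _; case: compatibleP => [/compatible_potential[c cE]|ncomp].
  by rewrite (card_potentials cE) hk -!natz natrX.
suff -> : potentials D f E = set0 by rewrite cards0 mulr0.
apply/setP => c; rewrite [RHS]inE; apply/negP => /potential_compatible.
by move=> /(_ o).
Qed.
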